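(* Let $\boldsymbol{\Psi}_p=\mathbf{D}\mathbf{Z}_p\mathbf{B}\in\mathbb{C}^{N\times QL}$ be the pilot sensing matrix, $\mathbf{R}_{pp}=\boldsymbol{\Psi}_p^H\boldsymbol{\Psi}_p$, and $N_{\mathrm{obs}}=\mathrm{rank}(\mathbf{Z}_p)$. Then $\mathrm{rank}(\boldsymbol{\Psi}_p)\le N_{\mathrm{obs}}$. Moreover, $\boldsymbol{\Psi}_p$ has full column rank, $\mathrm{rank}(\boldsymbol{\Psi}_p)=QL$, if and only if $\mathbf{R}_{pp}$ is positive definite, and in that case necessarily $N_{\mathrm{obs}}\ge QL$, i.e. $Q\le\lfloor N_{\mathrm{obs}}/L\rfloor$.
   Context: $N,L,Q$ are positive integers; $\mathbf{D}\in\mathbb{C}^{N\times N}$ is unitary; $\mathbf{B}=\mathbf{I}_L\otimes\boldsymbol{\Phi}\in\mathbb{C}^{NL\times QL}$ with $\boldsymbol{\Phi}\in\mathbb{C}^{N\times Q}$ the BEM basis matrix; $\mathbf{Z}_p=[\mathrm{diag}(\mathbf{z}_{p,0}),\ldots,\mathrm{diag}(\mathbf{z}_{p,L-1})]\in\mathbb{C}^{N\times NL}$, where $\mathbf{z}_{p,\ell}=\mathbf{S}_\ell\mathbf{x}_p\in\mathbb{C}^N$ is the known transmitted pilot vector $\mathbf{x}_p\in\mathbb{C}^N$ shifted by the delay-shift operator $\mathbf{S}_\ell\in\mathbb{C}^{N\times N}$ of the guard in use. The guard modes are (indices in $\{0,\ldots,N-1\}$): cyclic prefix, $\mathbf{S}_\ell=\boldsymbol{\Pi}^\ell$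 with $(\boldsymbol{\Pi}\mathbf{x})[n]=\mathbf{x}[(n-1)\bmod N]$; zero padding, $[\mathbf{S}_\ell]_{n,k}=1$ if $n=k+\ell$ and $0$ otherwise; chirp periodic prefix, $\mathbf{S}_\ell=\boldsymbol{\Omega}_\ell\boldsymbol{\Pi}^\ell$ with $\boldsymbol{\Omega}_\ell=\mathrm{diag}(\omega_\ell[k])_{k=0}^{N-1}$, $\omega_\ell[k]=e^{j2\pi c_1(\ell^2-2\ell k)/N}$ for $k<\ell$ and $1$ otherwise ($c_1$ a real parameter). *)

(* Defs.v *)
From mathcomp Require Import all_boot all_order all_algebra.
From mathcomp Require Import reals trigo.
From mathcomp Require Import complex.
(* mxtens is not imported: its notation [A ^t k] clashes with sesquilinear. *)
From mathcomp Require mxtens.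

Set Implicit Arguments.
Unset Strict Implicit.
Unset Printing Implicit Defensive.

Import Order.TTheory GRing.Theory Num.Theory.
Local Open Scope ring_scope.
Local Open Scope sesquilinear_scope.

Section PositiveDefinite.
Variable C : numClosedFieldType.

(* In a numClosedFieldType, [0 < z] means that z is real and positive. *)
Definition posdefmx n (A : 'M[C]_n) : Prop :=
  A \is hermsymmx /\
  forall v : 'cV[C]_n, v != 0 -> 0 < (v ^t* *m A *m v) 0 0.

End PositiveDefinite.

Section Blocks.
Variables (C : comNzRingType) (N L Q : nat).

(* [ F_0, ..., F_{L-1} ]: column n of the block l has index l * N + n, which
   is also the ordering of the rows of the Kronecker product [tensmx]. *)
Definition blockrow (F : 'I_L -> 'M[C]_N) : 'M[C]_(N, L * N) :=
  \matrix_(i, k)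
    F (mxtens.mxtens_unindex k).1 i (mxtens.mxtens_unindex k).2.

Definition bem_mx (Phi : 'M[C]_(N, Q)) : 'M[C]_(L * N, L * Q) :=
  mxtens.tensmx (1%:M : 'M[C]_L) Phi.

End Blocks.

Section Pilot.
Variable R : realType.

(* e^{j t} *)
Definition expj (t : R) : R[i] := (cos t +i* sin t)%C.

Inductive guard : Type :=
  | CyclicPrefix
  | ZeroPadding
  | ChirpPeriodicPrefix of R. (* the chirp parameter c_1 *)

Section Size.
Variable N : nat.

(* (Pi x)[n] = x[(n - 1) mod N]; the value of [ord_pred n] is
   (n + N).-1 %% N. *)
Definition cshift_mx : 'M[R[i]]_N := \matrix_(n, k) (k == ord_pred n)%:R.

Definition zpshift_mx (l : nat) : 'M[R[i]]_N :=
  \matrix_(n, k) ((n : nat) == k + l)%N%:R.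

Definition chirp_phase (c1 : R) (l k : nat) : R[i] :=
  if (k < l)%N
  then expj (2 * pi * c1 * (l%:R ^+ 2 - 2 * l%:R * k%:R) / N%:R)
  else 1.

Definition chirp_mx (c1 : R) (l : nat) : 'M[R[i]]_N :=
  diag_mx (\row_k chirp_phase c1 l k).

Definition shift_mx (g : guard) (l : nat) : 'M[R[i]]_N :=
  match g with
  | CyclicPrefix => cshift_mx ^+ l
  | ZeroPadding => zpshift_mx l
  | ChirpPeriodicPrefix c1 => chirp_mx c1 l *m cshift_mx ^+ l
  end.

Definition pilot_mx (L : nat) (g : guard) (x : 'cV[R[i]]_N) :
    'M[R[i]]_(N, L * N) :=
  blockrow (fun l : 'I_L => diag_mx (shift_mx g l *m x)^T).

Definition sensing_mx (L Q : nat) (D : 'M[R[i]]_N) (Phi : 'M[R[i]]_(N, Q))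
    (g : guard) (x : 'cV[R[i]]_N) : 'M[R[i]]_(N, L * Q) :=
  D *m pilot_mx L g x *m bem_mx L Phi.

End Size.
End Pilot.

(* Main.v *)
From Pilot Require Import Defs.
From mathcomp Require Import all_boot all_order all_algebra.
From mathcomp Require Import reals trigo.
From mathcomp Require Import complex.
Import Order.TTheory GRing.Theory Num.Theory.
Local Open Scope ring_scope.
Local Open Scope sesquilinear_scope.

(** Rank never grows under multiplication, so the product of [D], [Zp] and the basis matrix has rank
    at most that of [Zp]. For any [A], the Hermitian form of the Gram matrix at [v] is the squared
    norm of [A *m v] ([gram_form]). It is therefore positive at every nonzero [v] exactly when [A]
    kills no nonzero column, i.e. has full column rank ([mxrank_posdef_gramP]). The bound on [Q]
    combines full rank with the rank inequality. *)

Section Gram.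
Variable C : numClosedFieldType.

Lemma gram_hermsymmx m n (A : 'M[C]_(m, n)) : A ^t* *m A \is hermsymmx.
Proof.
apply/is_hermitianmxP.
by rewrite expr0 scale1r trmx_mul map_mxM trmxCK.
Qed.

Lemma gram_form m n (A : 'M[C]_(m, n)) (v : 'cV[C]_n) :
  (v ^t* *m (A ^t* *m A) *m v) 0 0 = \sum_i `|(A *m v) i 0| ^+ 2.
Proof.
rewrite mulmxA -mulmxA -map_mxM -trmx_mul mxE.
by apply: eq_bigr => i _; rewrite !mxE mulrC -normCK.
Qed.

(** A sum of nonnegative squares is zero only when every term is. *)
Lemma gram_form_gt0 m n (A : 'M[C]_(m, n)) (v : 'cV[C]_n) :
  (0 < (v ^t* *m (A ^t* *m A) *m v) 0 0) = (A *m v != 0).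
Proof.
rewrite gram_form lt0r sumr_ge0 ?andbT => [|i _]; last exact: exprn_ge0.
congr (~~ _); rewrite psumr_eq0 => [|i _]; last exact: exprn_ge0.
apply/allP/eqP => [Av0|-> i _]; last by rewrite mxE normr0 expr0n eqxx.
apply/colP => i; rewrite [RHS]mxE.
by have := Av0 i (mem_index_enum i); rewrite sqrf_eq0 normr_eq0 => /eqP.
Qed.

Lemma mxrank_posdef_gramP m n (A : 'M[C]_(m, n)) :
  \rank A = n <-> posdefmx (A ^t* *m A).
Proof.
(* Kernels and [row_free] concern row vectors acting on the left, so injectivity of [A] on columns
   is expressed through [A^T]. *)
have -> : posdefmx (A ^t* *m A) <-> row_free A^T.
  split=> [[_ pdA]|freeA].
    (* A nonzero row [u] in the left kernel of [A^T] would make [u^T] a nonzero column killed by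
       [A], where the form vanishes. *)
    rewrite -kermx_eq0; apply/rowV0P => u /sub_kermxP uA0.
    apply/eqP/negPn/negP => u_neq0.
    have: u^T != 0 by rewrite -trmx0 (inj_eq trmx_inj).
    move/pdA; rewrite gram_form_gt0 => /eqP[].
    by rewrite -[A]trmxK -trmx_mul uA0 trmx0.
  split=> [|v v_neq0]; first exact: gram_hermsymmx.
  rewrite gram_form_gt0; apply: contra v_neq0 => /eqP Av0.
  have: v^T *m A^T = 0 *m A^T by rewrite -trmx_mul Av0 trmx0 mul0mx.
  by move/(row_free_inj freeA)/eqP; rewrite -trmx0 (inj_eq trmx_inj).
by rewrite /row_free mxrank_tr; split=> /eqP.
Qed.

End Gram.

Lemma rank_sensing_mx_le (R : realType) (N L Q : nat) (D : 'M[R[i]]_N)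
    (Phi : 'M[R[i]]_(N, Q)) (g : guard R) (x : 'cV[R[i]]_N) :
  (\rank (sensing_mx L D Phi g x) <= \rank (pilot_mx L g x))%N.
Proof. exact: leq_trans (mxrankM_maxl _ _) (mxrankM_maxr _ _). Qed.

Theorem mainTheorem5 (R : realType) (N L Q : nat)
    (N_gt0 : (0 < N)%N) (L_gt0 : (0 < L)%N) (Q_gt0 : (0 < Q)%N)
    (D : 'M[R[i]]_N) (D_unitary : D \is unitarymx)
    (Phi : 'M[R[i]]_(N, Q)) (g : guard R) (x : 'cV[R[i]]_N) :
  let Zp := pilot_mx L g x in
  let Psi := sensing_mx L D Phi g x in
  let Rpp := Psi ^t* *m Psi in
  let Nobs := \rank Zp in
  [/\ (\rank Psi <= Nobs)%N,
      \rank Psi = (Q * L)%N <-> posdefmx Rpp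
    & \rank Psi = (Q * L)%N ->
      (Q * L <= Nobs)%N /\ (Q <= Nobs %/ L)%N].
Proof.
move=> Zp Psi Rpp Nobs.
have rank_le : (\rank Psi <= Nobs)%N by apply: rank_sensing_mx_le.
split=> //; first by rewrite [(Q * L)%N]mulnC; apply: mxrank_posdef_gramP.
(* As [L] is positive, the floor bound is equivalent to [Q * L <= Nobs], so both conjuncts reduce to
   [rank_le]. *)
by move=> rankPsi; rewrite leq_divRL // -rankPsi.
Qed.
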